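(* Let $Y$ be a Banach space such that both $Y$ and its dual $Y^*$ have the Radon–Nikodym property. Then any locally finite Borel regular measure on $Y$ that is concentrated on a separable set admits a decomposability bundle.
   Context: A Banach space $Y$ has the Radon–Nikodym property (RNP) if every Lipschitz $f:[0,1]\to Y$ is differentiable a.e. A Borel regular measure $\mu$ on $Y$ is concentrated on a separable set if there is a separable measurable set $E\subset Y$ with $\mu(Y\setminus E)=0$. Decomposability bundle of a measure $\mu$ on an RNP-Banach space $Y$: $\operatorname{Fr}(Y)$ is the set of curve fragments, i.e. bi-Lipschitz maps $\gamma:\operatorname{dom}(\gamma)\to Y$ from a compact set $\operatorname{dom}(\gamma)\subset\mathbb{R}$; the derivative $\gamma'(t)=\lim_{\operatorname{dom}(\gamma)\ni s\to t}\frac{\gamma(s)-\gamma(t)}{s-t}$ exists for a.e. $t\in\operatorname{dom}(\gamma)$. Let $\operatorname{Gr}(Y)$ be the collection of closed subspaces of $Y$. A map $V:Y\to\operatorname{Gr}(Y)$ is Borel if $\{(x,v):x\in Y,\ v\in V(x)\}\subset Y\times Y$ is Borel. It is a candidate (for the decomposability bundle) if there is a $\mu$-null set $N\subset Y$ such that $\gamma'(t)\in V(\gamma(t))$ for a.e. $t\in\operatorname{dom}(\gamma)$, for every $\gamma\in\operatorname{Fr}(Y)$ with $|\gamma^{-1}(N)|=0$ ($|\cdot|$ denotes Lebesgue measure). A decomposability bundle $T_\mu$ of $\mu$ is a Borel candidate such that $T_\mu(x)\subset V(x)$ for $\mu$-a.e. $x$, for every Borel candidate $V$. *)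

(* Defs.v *)
From HB Require Import structures.
From mathcomp Require Import all_boot all_order all_algebra.
From mathcomp Require Import all_classical all_reals all_analysis.

Set Implicit Arguments.
Unset Strict Implicit.
Unset Printing Implicit Defensive.

Import Order.TTheory GRing.Theory Num.Theory.
Import numFieldNormedType.Exports.

Local Open Scope classical_set_scope.
Local Open Scope ring_scope.

Section dual.
Context {R : realType} (Y : normedModType R).

Definition is_dual : {pred Y -> R^o} :=
  fun f => `[< scalar f /\ continuous f >].

Lemma is_dual_submod : submod_closed is_dual.
Proof.
split.
  rewrite /is_dual; apply/asboolP; split.
    by move=> a u v; rewrite /= mulr0 addr0.
  by move=> x; exact: cvg_cst.
move=> a f g /asboolP[lf cf] /asboolP[lg cg]; apply/asboolP; split.
  move=> b u v.
  rewrite !fctE lf lg /GRing.scale/= !mulrDr !mulrA [b * a]mulrC.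
  by rewrite addrACA.
move=> x; apply: (@cvgD _ _ _ _ _ (a \*: f) g); last exact: cg.
by apply: cvgZl_tmp; exact: cf.
Qed.

HB.instance Definition _ :=
  GRing.isSubmodClosed.Build R (Y -> R^o) is_dual is_dual_submod.

Record dual := Dual { dual_fun :> Y -> R^o ; _ : dual_fun \in is_dual }.

HB.instance Definition _ := [isSub for dual_fun].
HB.instance Definition _ := [Choice of dual by <:].
HB.instance Definition _ := [SubChoice_isSubLmodule of dual by <:].

Lemma dual_linear (f : dual) : scalar f.
Proof. by have /asboolP[] := valP f. Qed.

Lemma dual_continuous (f : dual) : continuous f.
Proof. by have /asboolP[] := valP f. Qed.

HB.instance Definition _ (f : dual) :=
  GRing.isLinear.Build R Y R^o _ f (dual_linear f).

Definition dual_norm (f : dual) : R := sup [set `|f x| | x in [set x | `|x| <= 1]].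

Lemma dual_norm_has_sup (f : dual) :
  has_sup [set `|f x| | x in [set x | `|x| <= 1]].
Proof.
split; first by exists `|f 0|, 0 => //=; rewrite normr0.
have /linear_bounded_continuous/linear_boundedP/pinfty_ex_gt0[r r0 fr] :=
  @dual_continuous f.
exists r => _ [x /= x1 <-]; apply: le_trans (fr x) _.
by rewrite ler_piMr// ltW.
Qed.

Lemma dual_norm_ub (f : dual) x : `|x| <= 1 -> `|f x| <= dual_norm f.
Proof. by move=> x1; apply: ub_le_sup; [case: (dual_norm_has_sup f)|exists x]. Qed.

Lemma dual_norm_le (f : dual) r :
  (forall x, `|x| <= 1 -> `|f x| <= r) -> dual_norm f <= r.
Proof.
move=> H; apply: ge_sup; first by case: (dual_norm_has_sup f).
by move=> _ [x /= x1 <-]; exact: H.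
Qed.

Lemma dual_normD f g : dual_norm (f + g) <= dual_norm f + dual_norm g.
Proof.
apply: dual_norm_le => x x1.
by rewrite (le_trans (ler_normD _ _))// lerD// dual_norm_ub.
Qed.

Lemma dual_normZ_le (a : R) f : dual_norm (a *: f) <= `|a| * dual_norm f.
Proof.
by apply: dual_norm_le => x x1; rewrite normrM ler_wpM2l// dual_norm_ub.
Qed.

Lemma dual_normZ (a : R) f : dual_norm (a *: f) = `|a| * dual_norm f.
Proof.
apply/eqP; rewrite eq_le dual_normZ_le/=.
have [->|a0] := eqVneq a 0.
  rewrite normr0 mul0r (le_trans _ (@dual_norm_ub _ 0 _))// normr0//.
rewrite -ler_pdivlMl ?normr_gt0// -normfV.
by rewrite (le_trans _ (dual_normZ_le _ _))// scalerA mulVf// scale1r.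
Qed.

Lemma dual_norm0_eq0 f : dual_norm f = 0 -> f = 0.
Proof.
move=> f0; apply/val_inj/funext => x.
have [->|x0] := eqVneq x 0; first exact: (raddf0 f).
have : `|f (`|x|^-1 *: x)| <= 0.
  by rewrite -f0 dual_norm_ub// normrZ normfV normr_id mulVf// normr_eq0.
rewrite normr_le0 linearZ/= mulf_eq0 invr_eq0 normr_eq0 (negPf x0)/=.
by move=> /eqP.
Qed.

HB.instance Definition _ := Lmodule_isNormed.Build R dual
  dual_normD dual_normZ dual_norm0_eq0.

End dual.

Section definitions.
Context {R : realType}.
Implicit Type Y : normedModType R.

(* The values of [f] outside [0, 1] only affect derivability at 0 and 1, hence
   not almost everywhere in [0, 1]. *)
Definition RNP Y := forall f : R -> Y,
  [lipschitz f x | x in `[0, 1]] ->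
  {ae @lebesgue_measure R, forall t, t \in `[0, 1] -> derivable f t 1}.

Definition borel {T : topologicalType} : set (set T) := <<s open >>.

Definition separable {T : topologicalType} (E : set T) :=
  exists D : set T, [/\ countable D, D `<=` E & E `<=` closure D].

Section measures.
Context {Y} (mu : {outer_measure set Y -> \bar R}).

(* As usual for Borel regular measures, [mu] is defined on all subsets. *)
Definition borel_regular :=
  (forall B, borel B -> mu.-caratheodory B) /\
  (forall A, exists B, [/\ borel B, A `<=` B & mu B = mu A]).

Definition locally_finite := forall x : Y, exists2 U, nbhs x U & (mu U < +oo)%E.

Definition concentrated_on_separable := exists E : set Y,
  [/\ mu.-caratheodory E, separable E & mu (~` E) = 0%E].

End measures.

(* Only the restriction of [frag_fun] to [frag_dom] is relevant. *)
Record fragment Y := Fragment {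
  frag_dom : set R ;
  frag_fun :> R -> Y ;
  frag_compact : compact frag_dom ;
  frag_bilipschitz : exists2 C : R, 0 < C & forall s t,
    frag_dom s -> frag_dom t ->
    C^-1 * `|s - t| <= `|frag_fun s - frag_fun t| <= C * `|s - t| }.

(* Vacuous at the (countably many) isolated points of the domain. *)
Definition frag_derivative Y (gamma : fragment Y) (t : R) (v : Y) :=
  (s - t)^-1 *: (gamma s - gamma t) @[s --> within (frag_dom gamma) t^'] --> v.

Record Gr Y := mkGr {
  Gr_set :> set Y ;
  Gr_closed : closed Gr_set ;
  Gr_submod : submod_closed [in Gr_set] }.

Definition Gr_borel Y (V : Y -> Gr Y) :=
  borel [set xv : Y * Y | Gr_set (V xv.1) xv.2].

Section bundle.
Context {Y} (mu : {outer_measure set Y -> \bar R}).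

(* [negligible] makes sense of |gamma^-1(N)| = 0 for a nonmeasurable N. *)
Definition candidate (V : Y -> Gr Y) := exists2 N : set Y, mu N = 0%E &
  forall gamma : fragment Y,
    (@lebesgue_measure R).-negligible (frag_dom gamma `&` gamma @^-1` N) ->
    {ae @lebesgue_measure R, forall t, frag_dom gamma t ->
      exists2 v, frag_derivative gamma t v & Gr_set (V (gamma t)) v}.

Definition decomposability_bundle (T : Y -> Gr Y) :=
  [/\ Gr_borel T, candidate T &
    forall V : Y -> Gr Y, Gr_borel V -> candidate V ->
      mu [set x | ~ (T x `<=` V x)] = 0%E].

End bundle.
End definitions.

(* Main.v *)
Require Import Defs.
From HB Require Import structures.
From mathcomp Require Import all_boot all_order all_algebra.
From mathcomp Require Import lra ring.
From mathcomp Require Import all_classical all_reals all_analysis.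

Set Implicit Arguments.
Unset Strict Implicit.
Unset Printing Implicit Defensive.

Import Order.TTheory GRing.Theory Num.Theory.
Import numFieldNormedType.Exports.

Local Open Scope classical_set_scope.
Local Open Scope ring_scope.

(** Candidates are stable under countable intersections, so the bundle is sought
as a countable intersection of Borel candidates that cannot be shrunk further
on a set of positive measure.

Separability reduces everything to countably many tests. The measure lives on
a closed separable subspace [W], and the constant map [W] is a candidate: by
the Radon-Nikodym property a fragment extended affinely over the gaps of its
domain is differentiable a.e. ([fragment_differentiable]), and a derivative at
an accumulation point of the times spent in [W] belongs to [W]
([candidate_cst]). A closed subspace [V x] of [W] is determined by the rational
balls that it meets, and [W] is covered by countably many open sets [Q] of
finite measure. For each ball [B] and each [Q], consider the set
[Phi V = {x in Q | V x meets B within W}]. Its measure is monotone in [V], and a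
minimizing sequence of candidates can be chosen for each of the countably many
pairs [(B, Q)]. The intersection [T] of all these candidates minimizes all the
measures at once. If [V'] is another Borel candidate and [S] is its intersection
with [T], then [Phi S] is contained in [Phi T] and has the same finite measure;
if [Phi S] is measurable, the difference is null. Outside these countably many
null sets [T x] is contained in [V' x], since a vector of [T x] outside the
closed set [V' x] would lie in a rational ball that misses [V' x].

The delicate point is the measurability of [Phi S], which is only the projection
of a Borel subset of [Y * Y] along the Polish space [W]. Borel sets are Suslin
([suslin_borel]), a projection along [W] of a Suslin set comes from a Suslin
scheme of closed sets ([projection_caratheodory]), and the Suslin operation
preserves measurability ([suslin_caratheodory]). *)

(** * Borel sets *)

Section borel_sets.
Context {T : topologicalType}.

Lemma borel_open (U : set T) : open U -> borel U.
Proof. exact: sub_sigma_algebra. Qed.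

Lemma borel_setC (A : set T) : borel A -> borel (~` A).
Proof. by move=> bA; rewrite -setTD; exact: sigma_algebraCD. Qed.

Lemma borel_closed (A : set T) : closed A -> borel A.
Proof.
move=> cA; rewrite -[A]setCK; apply: borel_setC; apply: borel_open.
exact: closed_openC.
Qed.

Lemma borel_bigcap (A : nat -> set T) :
  (forall n, borel (A n)) -> borel (\bigcap_n A n).
Proof.
move=> bA; rewrite -[X in borel X]setCK setC_bigcap; apply: borel_setC.
by apply: sigma_algebra_bigcup => n; exact: borel_setC.
Qed.

Lemma borel_setI (A B : set T) : borel A -> borel B -> borel (A `&` B).
Proof.
move=> bA bB; rewrite (_ : _ `&` _ = \bigcap_n (if n is 0%N then A else B)).
  by apply: borel_bigcap => -[].
apply/seteqP; split => [x [Ax Bx] [|n] _//|x H].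
split; first by have := H 0%N I.
by have := H 1%N I.
Qed.

End borel_sets.

(** * Null sets and the Suslin operation for outer measures *)

Section outer_measure_lemmas.
Context {R : realType} {T : Type} (mu : {outer_measure set T -> \bar R}).
Local Open Scope ereal_scope.

Lemma null_sub (A B : set T) : A `<=` B -> mu B = 0 -> mu A = 0.
Proof.
move=> AB B0; apply/eqP; rewrite eq_le outer_measure_ge0 andbT -B0.
exact: le_outer_measure.
Qed.

Lemma null_bigcup (I : countType) (F : I -> set T) :
  (forall i, mu (F i) = 0) -> mu (\bigcup_i F i) = 0.
Proof.
move=> F0; pose G n := if unpickle n is Some i then F i else set0.
apply: (@null_sub _ (\bigcup_n G n)).
  by move=> x [i _ Fix]; exists (pickle i) => //; rewrite /G pickleK.
apply/eqP; rewrite eq_le outer_measure_ge0 andbT.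
apply: le_trans (outer_measure_sigma_subadditive mu G) _.
rewrite eseries0// => n _ _; rewrite /G.
by case: unpickle => // ; rewrite outer_measure0.
Qed.

Lemma caratheodory_null (A : set T) : mu A = 0 -> mu.-caratheodory A.
Proof.
move=> A0; apply: le_caratheodory_measurable => X.
by rewrite (@null_sub (X `&` A) A)// add0e le_outer_measure.
Qed.

Lemma null_diff (A B : set T) : mu.-caratheodory A -> A `<=` B ->
  mu B < +oo -> mu B <= mu A -> mu (B `\` A) = 0.
Proof.
move=> cA AB Boo BA.
have := cA B; rewrite (setIidr AB) -setDE => mB.
have mAfin : mu A \is a fin_num.
  by rewrite ge0_fin_numE ?outer_measure_ge0// (le_lt_trans _ Boo)//
    le_outer_measure.
apply/eqP; rewrite eq_le outer_measure_ge0 andbT.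
by rewrite -(leeD2lE _ _ mAfin) adde0 -mB.
Qed.

(** The Suslin operation preserves measurability. Replace each [A s] by a
measurable hull [H s] inside [E s]. Since [A s] is covered by its children,
[H s] exceeds the union of the hulls of its children only by a null set. Off the
countable union of these null sets, every point of the root hull can be followed
from child to child along an infinite branch, and so belongs to [A [::]]. Hence
[A [::]] differs from its hull by a null set. *)
Lemma suslin_caratheodory (A E : seq nat -> set T) :
  (forall X, exists B, [/\ mu.-caratheodory B, X `<=` B & mu B = mu X]) ->
  mu (A [::]) < +oo ->
  (forall s, A s `<=` A [::]) ->
  (forall s, A s `<=` \bigcup_n A (rcons s n)) ->
  (forall s, A s `<=` E s) -> (forall s, mu.-caratheodory (E s)) ->
  (forall f x, (forall n, E (mkseq f n) x) -> A [::] x) ->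
  mu.-caratheodory (A [::]).
Proof.
move=> hull Aoo A0 AS AE cE branch.
have {hull} /choice[H HP] : forall s, exists H,
    [/\ mu.-caratheodory H, A s `<=` H, H `<=` E s & mu H = mu (A s)].
  move=> s; have [B [cB AB mB]] := hull (A s); exists (B `&` E s); split.
  - exact: caratheodory_measurable_setI.
  - by move=> x Ax; split; [exact: AB|exact: AE].
  - by move=> x [].
  - apply/eqP; rewrite eq_le -{1}mB !le_outer_measure//.
    by move=> x Ax; split; [exact: AB|exact: AE].
pose N s := H s `\` \bigcup_n H (rcons s n).
have N0 : mu (\bigcup_s N s) = 0.
  apply: null_bigcup => s; have [cH AH HE mH] := HP s.
  have Hoo : mu (H s) < +oo by rewrite mH (le_lt_trans _ Aoo)// le_outer_measure.
  apply: (@null_sub _ (H s `\` (H s `&` \bigcup_n H (rcons s n)))).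
    by move=> x [Hx nHx]; split => // -[].
  apply: null_diff => //.
    apply: caratheodory_measurable_setI => //.
    by apply: caratheodory_measurable_bigcup => n; case: (HP (rcons s n)).
  rewrite mH le_outer_measure// => x Ax; split; first exact: AH.
  have [n _ Anx] := AS _ _ Ax; exists n => //.
  by case: (HP (rcons s n)) => _ + _ _; apply.
have [cH AH HE mH] := HP [::].
have HA : mu (H [::] `\` A [::]) = 0.
  apply: null_sub N0 => x [Hx nAx]; apply: contrapT => nN; apply: nAx.
  have step s : exists n, H s x -> H (rcons s n) x.
    have [Hs|] := pselect (H s x); last by exists 0%N.
    suff [n] : exists n, H (rcons s n) x by exists n.
    apply: contrapT => nex; apply: nN; exists s => //; split => // -[n _ Hn].
    by apply: nex; exists n.
  have {step} /choice[f fP] := step.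
  pose t n := iter n (fun s => rcons s (f s)) [::].
  have tE n : mkseq (f \o t) n = t n.
    by elim: n => // n ih; rewrite mkseqS ih.
  apply: (branch (f \o t)) => n; case: (HP (t n)) => _ _ + _; rewrite tE; apply.
  by elim: n => // n ih; exact: fP.
have -> : A [::] = H [::] `\` (H [::] `\` A [::]).
  rewrite setDD; apply/seteqP; split => [x Ax|x []//].
  by split => //; exact: AH.
by apply: caratheodory_measurable_setD => //; exact: caratheodory_null.
Qed.

End outer_measure_lemmas.

(** * Suslin sets *)

Section suslin.
Context {Z : topologicalType}.

(** The set of pairs [(s, z)] with [F s z] is closed in the product of the Baire
space with [Z]; the cylinders of sequences that agree with [s] below [n] form a
base of neighbourhoods of [s]. *)
Definition baire_closed (F : (nat -> nat) -> set Z) := forall s z,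
  (forall n U, nbhs z U -> exists t z',
    [/\ forall i, (i < n)%N -> t i = s i, U z' & F t z']) -> F s z.

Definition suslin (A : set Z) :=
  exists2 F, baire_closed F & A = \bigcup_s F s.

Lemma suslin_closed (A : set Z) : closed A -> suslin A.
Proof.
move=> cA; exists (fun=> A); last first.
  by apply/seteqP; split => [x Ax|x [_ _]//]; exists (fun=> 0%N).
move=> s z H; apply: cA => U zU; have [_ [z' [_ Uz' Az']]] := H 0%N U zU.
by exists z'.
Qed.

(** The first term of a sequence selects the index of the union. *)
Lemma suslin_bigcup (A : nat -> set Z) :
  (forall k, suslin (A k)) -> suslin (\bigcup_k A k).
Proof.
move=> /(_ _)/cid2-/all_sig2[F cF AE].
exists (fun s => F (s 0%N) (s \o S)).
  move=> s z H; apply: cF => n U zU.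
  have [t [z' [ts Uz' Fz']]] := H n.+1 U zU.
  exists (t \o S), z'; split => //; last by rewrite -ts.
  by move=> i ni; exact: ts.
apply/seteqP; split => [x [k _]|x [s _ Fsx]].
  rewrite AE => -[s _ Fx].
  by exists (fun n => if n is n'.+1 then s n' else k).
by exists (s 0%N) => //; rewrite AE; exists (s \o S).
Qed.

(** One sequence codes countably many sequences through a pairing of indices; each
coordinate below [n] of the [k]-th sequence is read below a common bound. *)
Lemma suslin_bigcap (A : nat -> set Z) :
  (forall k, suslin (A k)) -> suslin (\bigcap_k A k).
Proof.
move=> /(_ _)/cid2-/all_sig2[F cF AE].
exists (fun s => \bigcap_k F k (fun i => s (pickle (k, i)))).
  move=> s z H k _; apply: cF => n U zU.
  have [t [z' [ts Uz' Fz']]] := H (\sum_(i < n) pickle (k, val i)).+1 U zU.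
  exists (fun i => t (pickle (k, i))), z'; split => //; last exact: Fz'.
  move=> i ni; apply: ts; rewrite ltnS (bigD1 (Ordinal ni))//=.
  exact: leq_addr.
apply/seteqP; split => [x Ax|x [s _ Fsx] k _].
  have /choice[s sP] : forall k, exists s, F k s x.
    by move=> k; have := Ax k I; rewrite AE => -[s _ Fx]; exists s.
  exists (fun m => if unpickle m is Some (k, i) then s k i else 0%N) => //.
  move=> k _; rewrite (_ : (fun i => _) = s k)//.
  by apply/funext => i; rewrite pickleK.
by rewrite AE; exists (fun i => s (pickle (k, i))) => //; exact: Fsx.
Qed.

End suslin.

(** An open set is the union of the closed sets of its points at distance at
least [n.+1%:R^-1] from the complement. *)
Lemma suslin_open {R : realType} (Z : normedModType R) (A : set Z) :
  open A -> suslin A.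
Proof.
move=> oA.
pose C n := [set z | forall u, ~ A u -> n.+1%:R^-1 <= `|z - u|].
have -> : A = \bigcup_n C n.
  apply/seteqP; split => [z Az|z [n _ Cz]].
    have /nbhs_ballP[e /= e0 eA] : nbhs z A by exact: open_nbhs_nbhs.
    have /ltr_add_invr[n] := e0; rewrite add0r => ne; exists n => //= u nAu.
    rewrite leNgt; apply/negP => zu; apply: nAu; apply: eA.
    by rewrite -ball_normE /=; exact: lt_trans ne.
  apply: contrapT => nAz; have /= := Cz z nAz.
  by rewrite subrr normr0 leNgt invr_gt0 ltr0n.
apply: suslin_bigcup => n; apply: suslin_closed.
rewrite (_ : C n = \bigcap_(u in ~` A)
    ((fun z => `|z - u|) @^-1` [set r | n.+1%:R^-1 <= r])).
  apply: closed_bigI => u _; apply: preimage_closed; last exact: closed_ge.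
  by move=> z _; apply: cvg_norm; apply: cvgB; [exact: cvg_id|exact: cvg_cst].
by apply/seteqP; split => z /= Cz u; exact: Cz.
Qed.

(** The Suslin sets whose complement is Suslin form a sigma-algebra. *)
Lemma suslin_borel {R : realType} (Z : normedModType R) (B : set Z) :
  borel B -> suslin B.
Proof.
move=> bB; suff [] : suslin B /\ suslin (~` B) by [].
apply: (bB [set A | suslin A /\ suslin (~` A)]); split; last first.
  move=> A oA; split; first exact: suslin_open.
  by apply: suslin_closed; exact: open_closedC.
split.
- split; apply: suslin_closed; first exact: closed0.
  by rewrite setC0; exact: closedT.
- by move=> A [sA sCA]; rewrite /= setTD setCK.
- move=> A sA; split; first by apply: suslin_bigcup => n; case: (sA n).
  by rewrite setC_bigcup; apply: suslin_bigcap => n; case: (sA n).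
Qed.

(** * Projections of Borel sets *)

Section projection.
Context {R : realType} {Y : completeNormedModType R}.
Context (mu : {outer_measure set Y -> \bar R}).

(** A point [y] of the separable set is coded by the indices of points of [w] at
distance at most [n.+1%:R^-1] from [y], so that the projected coordinate becomes
part of the Suslin code. Prefixes of the code give a scheme of closed sets. If
[x] lies in all the closed sets along a branch, nearby points of the projection
come with second coordinates that form a Cauchy sequence, as they share longer
and longer codes; its limit [y] exists by completeness and, the code being a
closed relation, witnesses that [x] is in the projection. *)
Lemma projection_caratheodory (w : nat -> Y) (B : set (Y * Y)) :
  borel_regular mu -> borel B ->
  (mu [set x | exists2 y, closure (range w) y & B (x, y)] < +oo)%E ->
  mu.-caratheodory [set x | exists2 y, closure (range w) y & B (x, y)].
Proof.
move=> [cB hB] /suslin_borel[F cF BE].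
(* The sequence [r] codes two sequences: a Suslin code and indices for [w]. *)
pose p (m : nat) : nat * nat := odflt (0, 0)%N (unpickle m).
pose P (r : nat -> nat) x y := (forall n, `|w (p (r n)).2 - y| <= n.+1%:R^-1)
  /\ F (fun i => (p (r i)).1) (x, y).
pose A (s : seq nat) := [set x : Y | exists r y, mkseq r (size s) = s /\ P r x y].
have -> : [set x | exists2 y, closure (range w) y & B (x, y)] = A [::].
  apply/seteqP; split => [x [y yw]|x [r [y [_ [ry Fr]]]]].
    rewrite BE => -[s _ Fs].
    have /choice[t tP] : forall n, exists k, `|w k - y| <= n.+1%:R^-1.
      move=> n; have /yw[_ [[k _ <-]]] : nbhs y (ball y n.+1%:R^-1).
        by apply: nbhsx_ballx; rewrite invr_gt0 ltr0n.
      by rewrite -ball_normE /= distrC => /ltW; exists k.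
    exists (fun i => pickle (s i, t i)), y; split => //; split.
      by move=> n; rewrite /p pickleK; exact: tP.
    by rewrite (_ : (fun i => _) = s)//; apply/funext => i; rewrite /p pickleK.
  exists y; last by rewrite BE; exists (fun i => (p (r i)).1).
  move=> U /nbhs_ballP[e /= e0 eU].
  have /ltr_add_invr[n] := e0; rewrite add0r => ne.
  exists (w (p (r n)).2); split; first by exists (p (r n)).2.
  by apply: eU; rewrite -ball_normE /= distrC; exact: le_lt_trans ne.
move=> Aoo; apply: (@suslin_caratheodory _ _ _ _ (fun s => closure (A s))) => //.
- move=> X; have [D [bD XD mD]] := hB X; exists D; split => //; exact: cB.
- by move=> s x [r [y [_ ?]]]; exists r, y.
- move=> s x [r [y [rs ?]]]; exists (r (size s)) => //; exists r, y.
  by rewrite size_rcons mkseqS rs.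
- by move=> s; exact: subset_closure.
- move=> s; apply: cB.
  by apply: borel_closed; exact: closed_closure.
move=> f x fx.
have /choice[x_ /(_ _)/cid-/all_sig[r_ /(_ _)/cid-/all_sig[y_ xP]]] :
    forall n, exists x' r y, [/\ `|x - x'| < n.+1%:R^-1,
      forall i, (i < n)%N -> r i = f i & P r x' y].
  move=> n; have /(fx n)[x' [[r [y [rE Pr]]] xx']] : nbhs x (ball x n.+1%:R^-1).
    by apply: nbhsx_ballx; rewrite invr_gt0 ltr0n.
  exists x', r, y; split => //; first by move: xx'; rewrite -ball_normE.
  move=> i ni; move: rE; rewrite size_mkseq => /(congr1 (fun s => nth 0%N s i)).
  by rewrite !nth_mkseq.
pose tau i := (p (f i)).2.
have wy i n : (i < n)%N -> `|w (tau i) - y_ n| <= i.+1%:R^-1.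
  by move=> ni; have [_ rf [+ _]] := xP n; rewrite /tau -rf.
have invr_small (e : R) : 0 < e -> \forall n \near \oo, n.+1%:R^-1 < e.
  by move=> e0; apply: near_infty_natSinv_lt (PosNum e0).
have /cauchy_cvgP/cvg_ex[y yy] : cauchy (y_ @ \oo).
  apply/cauchy_ballP => e e0.
  have /invr_small[i _ /(_ i (leqnn i)) ii] : 0 < e / 2 by rewrite divr_gt0.
  exists (y_ @` [set n | (i < n)%N], y_ @` [set n | (i < n)%N]).
    by split; apply: filterS (nbhs_infty_gt i) => n ?; exists n.
  move=> [_ _] /= [[n ni <-] [m mi <-]]; rewrite -ball_normE /= [e]splitr.
  rewrite -(subrKA (w (tau i))) (le_lt_trans (ler_normD _ _))//.
  by apply: ltrD; apply: le_lt_trans ii; [rewrite distrC|]; exact: wy.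
have xx : x_ @ \oo --> x.
  apply/cvgrPdist_lt => e e0; near=> n; have [+ _ _] := xP n => /lt_trans; apply.
  by near: n; exact: invr_small.
exists f, y; split => //; split.
  move=> i; rewrite -/(tau i).
  have : (fun n => `|w (tau i) - y_ n|) @ \oo --> `|w (tau i) - y|.
    by apply: cvg_norm; apply: cvgB => //; exact: cvg_cst.
  move=> /(@cvgr_to_le); apply.
  by near=> n; apply: wy; near: n; exact: nbhs_infty_gt.
apply: cF => n U xyU.
have : \forall m \near \oo, U (x_ m, y_ m).
  exact: (cvg_pair xx yy).
move=> [N _ NU]; pose m := maxn n N.
exists (fun i => (p (r_ m i)).1), (x_ m, y_ m); split.
- move=> i ni; have [_ rf _] := xP m; rewrite rf//.
  by rewrite (leq_trans ni)// leq_maxl.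
- by apply: NU; exact: leq_maxr.
- by have [_ _ []] := xP m.
Unshelve. all: by end_near. Qed.

End projection.

(** * Lipschitz extension from a compact subset of the line *)

Section lipschitz_extension.
Context {R : realType} {Y : normedModType R}.

Lemma compact_floor (K : set R) (m t : R) : compact K -> K m -> m <= t ->
  exists a, [/\ K a, a <= t & forall k, K k -> k <= t -> k <= a].
Proof.
move=> cK Km mt.
have [|||c /set_mem[Kc ct] cM] := @compact_EVT_max R R idfun (K `&` [set x | x <= t]).
- by exists m.
- by apply: compact_closedI => //; exact: closed_le.
- by apply: continuous_subspaceT => x; exact: cvg_id.
by exists c; split => // k Kk kt; apply: cM; rewrite inE.
Qed.

Lemma compact_ceil (K : set R) (M t : R) : compact K -> K M -> t <= M ->
  exists b, [/\ K b, t <= b & forall k, K k -> t <= k -> b <= k].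
Proof.
move=> cK KM tM.
have [|||c /set_mem[Kc ct] cm] := @compact_EVT_min R R idfun (K `&` [set x | t <= x]).
- by exists M.
- by apply: compact_closedI => //; exact: closed_ge.
- by apply: continuous_subspaceT => x; exact: cvg_id.
by exists c; split => // k Kk kt; apply: cm; rewrite inE.
Qed.

(** Interpolate affinely over the gap [[a t, b t]] of [K] around [t], after moving
[t] to the convex hull of [K]. The constant is preserved: inside a gap the slope
is that of a chord of [g], and two points in different gaps are compared through
the ends of their gaps. *)
Lemma lipschitz_extension (K : set R) (g : R -> Y) (C : R) :
  compact K -> 0 <= C ->
  (forall s t, K s -> K t -> `|g s - g t| <= C * `|s - t|) ->
  exists2 f : R -> Y, (forall s t, `|f s - f t| <= C * `|s - t|) &
    forall t, K t -> f t = g t.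
Proof.
move=> cK C0 gC; have [K0|/set0P[k0 Kk0]] := eqVneq K set0.
  exists (fun=> 0) => [s t|t]; last by rewrite K0.
  by rewrite subrr normr0 mulr_ge0.
have [m /set_mem Km mK] := @compact_EVT_min R R idfun K
  (ex_intro _ _ Kk0) cK (continuous_subspaceT (fun=> cvg_id)).
have [M /set_mem KM MK] := @compact_EVT_max R R idfun K
  (ex_intro _ _ Kk0) cK (continuous_subspaceT (fun=> cvg_id)).
pose cl t := Num.max m (Num.min M t).
have mM : m <= M by apply: MK; exact/mem_set.
have clm t : m <= cl t by rewrite le_max lexx.
have clM t : cl t <= M by rewrite ge_max mM ge_min lexx.
have clE t : K t -> cl t = t.
  move=> /mem_set Kt; rewrite /cl (min_idPr _) ?(max_idPr _)//; first exact: mK.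
  exact: MK.
have cl_lip s t : s <= t -> 0 <= cl t - cl s <= t - s.
  move=> st; rewrite /cl /Num.max /Num.min.
  by case: (ltP M s) => Ms; case: (ltP M t) => Mt; case: ltP => ?; case: ltP => ?; lra.
have /choice[a aP] : forall t, exists a,
    [/\ K a, a <= cl t & forall k, K k -> k <= cl t -> k <= a].
  by move=> t; exact: compact_floor (clm t).
have /choice[b bP] : forall t, exists b,
    [/\ K b, cl t <= b & forall k, K k -> cl t <= k -> b <= k].
  by move=> t; exact: compact_ceil (clM t).
pose f t := g (a t) + ((cl t - a t) / (b t - a t)) *: (g (b t) - g (a t)).
have gba t : `|g (b t) - g (a t)| <= C * (b t - a t).
  have [Ka at_ _] := aP t; have [Kb bt _] := bP t.
  by rewrite (le_trans (gC _ _ Kb Ka))// ger0_norm// subr_ge0 (le_trans at_).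
(* At a point of [K] the gap is degenerate and the quotient is [0 / 0 = 0]. *)
have scale_le (x y : R) t : 0 <= x -> a t <= b t -> (a t = b t -> y = 0) ->
    x = y / (b t - a t) -> `|x *: (g (b t) - g (a t))| <= C * y.
  move=> x0 ab y0 xE; rewrite normrZ ger0_norm//.
  have [{}ab|{}ab] := eqVneq (a t) (b t).
    by rewrite y0// mulr0 ab subrr normr0 mulr0.
  rewrite (le_trans (ler_wpM2l x0 (gba t)))// mulrCA xE mulfVK//.
  by rewrite subr_eq0 eq_sym.
have fa t : `|f t - g (a t)| <= C * (cl t - a t).
  have [Ka at_ _] := aP t; have [Kb bt _] := bP t.
  rewrite /f addrC addKr; apply: scale_le => //.
  - by rewrite divr_ge0// subr_ge0// (le_trans at_).
  - exact: le_trans bt.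
  - by move=> ab; apply/eqP; rewrite eq_le subr_ge0 at_ subr_le0 ab bt.
have fb t : `|f t - g (b t)| <= C * (b t - cl t).
  have [Ka at_ _] := aP t; have [Kb bt _] := bP t.
  have [ab|ab] := eqVneq (a t) (b t).
    by rewrite /f ab !subrr scaler0 addr0 subrr normr0 mulr_ge0// subr_ge0.
  have ab0 : b t - a t != 0 by rewrite subr_eq0 eq_sym.
  rewrite -normrN opprB /f opprD addrA -[X in X - _]scale1r -scalerBl.
  apply: scale_le => //.
  - rewrite subr_ge0 ler_pdivrMr ?mul1r ?lerB// lt_neqAle eq_sym ab0 subr_ge0.
    exact: le_trans bt.
  - exact: le_trans bt.
  - by move/eqP; rewrite (negPf ab).
  - by field.
exists f; last first.
  move=> t Kt; have [Ka + aM] := aP t; rewrite clE// => at_.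
  have aE : a t = t by apply/eqP; rewrite eq_le at_ aM// clE.
  by rewrite /f clE// aE subrr mul0r scale0r addr0.
have main s t : s <= t -> `|f t - f s| <= C * (t - s).
  move=> st; have /andP[cst cts] := cl_lip _ _ st.
  rewrite subr_ge0 in cst; apply: (@le_trans _ _ (C * (cl t - cl s))); last first.
    exact: ler_wpM2l.
  have [Kas as_ asM] := aP s; have [Kbs bs bsm] := bP s.
  have [Kat at_ atM] := aP t; have [Kbt bt btm] := bP t.
  have [bst|bst] := leP (b s) (cl t).
    have bsat : b s <= a t by exact: atM.
    have -> : f t - f s = (f t - g (a t)) + (g (a t) - g (b s)) - (f s - g (b s)).
      by rewrite subrKA opprB addrA subrK.
    rewrite (le_trans (ler_normB _ _))// (le_trans (lerD (ler_normD _ _) (fb s)))//.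
    have := gC _ _ Kat Kbs; rewrite ger0_norm ?subr_ge0// => gab.
    have := fa t; nra.
  have aE : a t = a s.
    apply/eqP; rewrite eq_le atM ?(le_trans as_)// andbT asM//.
    rewrite leNgt; apply/negP => /ltW sa; have := bsm _ Kat sa.
    by rewrite leNgt (le_lt_trans at_ bst).
  have bE : b t = b s.
    by apply/eqP; rewrite eq_le btm ?(ltW bst)//= bsm// (le_trans cst).
  have -> : f t - f s = ((cl t - cl s) / (b s - a s)) *: (g (b s) - g (a s)).
    rewrite /f aE bE opprD addrACA subrr add0r -scalerBl -mulrBl; congr (_ / _ *: _).
    by ring.
  apply: scale_le => //.
  - by rewrite divr_ge0 ?subr_ge0// (le_trans as_).
  - exact: le_trans bs.
  - move=> ab; apply/eqP; rewrite eq_le !subr_ge0 cst andbT subr_le0.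
    by rewrite (le_trans (ltW bst))// -ab.
move=> s t; have [st|/ltW ts] := leP s t.
  by rewrite distrC [`|s - t|]distrC ger0_norm ?subr_ge0// main.
by rewrite ger0_norm ?subr_ge0// main.
Qed.

End lipschitz_extension.

(** * Differentiability of curve fragments *)

Section fragments.
Context {R : realType}.
Local Notation leb := (@lebesgue_measure R).

Lemma ae_imply (P Q : R -> Prop) : (forall t, P t -> Q t) ->
  {ae leb, forall t, P t} -> {ae leb, forall t, Q t}.
Proof. by move=> PQ; apply: negligibleS => t /= nQ Pt; apply: nQ; exact: PQ. Qed.

(** Lebesgue measure is, up to the factor [L^-1], its own pushforward under the
affine map. *)
Lemma ae_affine (m L : R) (P : R -> Prop) : 0 < L ->
  {ae leb, forall s, P s} -> {ae leb, forall t, P (L^-1 * (t - m))}.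
Proof.
move=> L0 [A [mA A0 PA]].
pose phi (t : measurableTypeR R) : measurableTypeR R := L^-1 * (t - m).
have mphi : measurable_fun setT phi.
  apply: measurable_realfun.continuous_measurable_fun => t.
  by apply: cvgM; [exact: cvg_cst|apply: cvgB; [exact: cvg_id|exact: cvg_cst]].
have L1 : 0 <= L^-1 by rewrite invr_ge0 ltW.
exists (phi @^-1` A); split.
- by rewrite -[X in measurable X]setTI; exact: mphi.
- pose nu := mscale (NngNum L1) (pushforward leb phi).
  have : leb A = nu mphi A.
    apply: lebesgue_measure_unique => //= _ [[a b]] _ <-.
    rewrite /nu /mscale /= /pushforward.
    rewrite (_ : _ @^-1` _ = `]m + L * a, m + L * b]%classic); last first.
      apply/seteqP; split => x /=; rewrite !in_itv/= /phi.
        by rewrite ltr_pdivlMl// ler_pdivrMl// => /andP[? ?]; apply/andP; split; lra.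
      by rewrite ltr_pdivlMl// ler_pdivrMl// => /andP[? ?]; apply/andP; split; lra.
    rewrite !lebesgue_measure_itv/= !lte_fin ltrD2l ltr_pM2l//.
    case: ifP => _; last by rewrite mule0.
    by rewrite -!EFinD -EFinM; congr EFin; field; rewrite gt_eqF.
  rewrite A0 /nu /mscale /= /pushforward => /esym/eqP.
  by rewrite mule_eq0 eqe invr_eq0 gt_eqF//= => /eqP.
- by move=> t nP; apply: PA.
Qed.

Context {Y : normedModType R}.

(** Extend the fragment to a Lipschitz curve on the line and rescale an interval
around the domain to [[0, 1]], where the Radon-Nikodym property applies. *)
Lemma fragment_differentiable (gamma : fragment Y) : RNP Y ->
  {ae leb, forall t, frag_dom gamma t -> exists v, frag_derivative gamma t v}.
Proof.
move=> rnp; set K := frag_dom gamma.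
have cK : compact K := @frag_compact _ _ gamma.
have [C C0 gC] := frag_bilipschitz gamma.
have [f fC fE] := @lipschitz_extension _ _ K gamma C cK (ltW C0)
  (fun s t Ks Kt => proj2 (andP (gC s t Ks Kt))).
have [r r0 Kr] : exists2 r : R, 0 < r & forall t, K t -> `|t| < r.
  by have /ex_strict_bound_gt0[r r0 Kr] := compact_bounded cK; exists r.
have [L L0 LE] : exists2 L, 0 < L & L = 2 * r.
  by exists (2 * r) => //; rewrite mulr_gt0.
pose h (s : R) := f (- r + L * s).
have /rnp hd : [lipschitz h x | x in `[0, 1]].
  have PF : ProperFilter (globally (`[0 : R, 1]%classic `*` `[0 : R, 1]%classic)).
    by apply: (@globally_properfilter _ _ (0, 0)); split;
      rewrite /= in_itv/= lexx ler01.
  apply: (@klipschitzW _ _ _ (C * L)) => -[s t] _ /=.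
  rewrite /h (le_trans (fC _ _))// -mulrA ler_pM2l//.
  by rewrite opprD addrACA subrr add0r -mulrBr normrM gtr0_norm.
have := @ae_affine (- r) L _ L0 hd; apply: ae_imply => t ht Kt.
have {ht} /cvg_ex[v hv] : derivable h (L^-1 * (t - - r)) 1.
  apply: ht; rewrite in_itv/=; have := Kr t Kt; rewrite ltr_norml => /andP[? ?].
  rewrite mulr_ge0 ?invr_ge0 ?(ltW L0)//=; last by lra.
  by rewrite ler_pdivrMl// LE; lra.
exists (L^-1 *: v).
have tL : (fun s : R => L^-1 * (s - t)) @ within K t^' --> 0^'.
  apply: cvg_within_filter => A; rewrite /nbhs/= /dnbhs /within/= => A0.
  have : (fun s : R => L^-1 * (s - t)) @ t --> L^-1 * (t - t).
    by apply: cvgM; [exact: cvg_cst|apply: cvgB; [exact: cvg_id|exact: cvg_cst]].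
  rewrite subrr mulr0 => /(_ _ A0).
  apply: (@filterS _ (nbhs t)) => s /= As st; apply: As.
  by rewrite mulf_neq0 ?invr_neq0 ?subr_eq0// gt_eqF.
have FK : Filter (within K t^') by exact: within_filter.
have /(_ FK) := cvgZl_tmp (k := L^-1) (cvg_comp _ _ tL hv).
rewrite /frag_derivative; apply: cvg_trans.
apply: near_eq_cvg; rewrite near_withinE; near=> s => Ks.
rewrite /= /h opprK.
have -> : - r + L * ((L^-1 * (s - t)) *: 1 + L^-1 * (t + r)) = s.
  by rewrite /GRing.scale/=; field; rewrite gt_eqF.
have -> : - r + L * (L^-1 * (t + r)) = t by field; rewrite gt_eqF.
by rewrite !fE// scalerA invfM invrK mulrA mulVf ?gt_eqF// mul1r.
Unshelve. all: by end_near. Qed.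

End fragments.

(** * Closed subspaces *)

Section subspaces.
Context {R : realType} {Y : normedModType R}.

Lemma submod_closedP (A : set Y) : submod_closed [in A] <->
  A 0 /\ forall a u v, A u -> A v -> A (a *: u + v).
Proof.
split=> [[A0 AD]|[A0 AD]].
  by split=> [|a u v /mem_set Au /mem_set Av]; apply/set_mem => //; exact: AD.
split; first exact/mem_set.
by move=> a u v /set_mem Au /set_mem Av; apply/mem_set; exact: AD.
Qed.

Lemma Gr0 (V : Gr Y) : Gr_set V 0.
Proof. by have /submod_closedP[] := Gr_submod V. Qed.

Lemma Gr_bigcap_closed (I : Type) (V : I -> Gr Y) : closed (\bigcap_i V i).
Proof. by apply: closed_bigI => i _; exact: Gr_closed. Qed.

Lemma Gr_bigcap_submod (I : Type) (V : I -> Gr Y) :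
  submod_closed [in \bigcap_i V i].
Proof.
apply/submod_closedP; split=> [i _|a u v Vu Vv i _]; first exact: Gr0.
have /submod_closedP[_] := Gr_submod (V i); apply; [exact: Vu|exact: Vv].
Qed.

Definition Gr_bigcap (I : Type) (V : I -> Gr Y) : Gr Y :=
  mkGr (@Gr_bigcap_closed I V) (@Gr_bigcap_submod I V).

(** The sequence enumerates the rational linear combinations of a countable set;
their closure is stable under real scalars by joint continuity of [a *: u + v]. *)
Lemma separable_closed_span (D : set Y) : countable D -> exists w : nat -> Y,
  D `<=` range w /\ submod_closed [in closure (range w)].
Proof.
move=> /pcard_surjP[d dD].
pose w n : Y := \sum_(p <- odflt [::] (unpickle n : option (seq (rat * nat))))
  ratr p.1 *: d p.2.
have wE (s : seq (rat * nat)) : range w (\sum_(p <- s) ratr p.1 *: d p.2).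
  by exists (pickle s) => //; rewrite /w pickleK.
have wD q u v : range w u -> range w v -> range w (ratr q *: u + v).
  move=> [n _ <-] [m _ <-]; rewrite /w.
  set s := odflt _ _; set t := odflt _ _.
  rewrite (_ : _ + _ = \sum_(p <- [seq (q * p.1, p.2) | p <- s] ++ t)
    ratr p.1 *: d p.2) //.
  rewrite big_cat big_map/= scaler_sumr; congr (_ + _).
  by apply: eq_bigr => p _; rewrite rmorphM scalerA.
exists w; split.
  move=> y /dD[n _ <-].
  by have := wE [:: (1, n)]; rewrite big_seq1/= rmorph1 scale1r.
apply/submod_closedP; split.
  by apply: subset_closure; have := wE [::]; rewrite big_nil.
move=> a u v wu wv U.
have cvgL : (fun z : R * Y * Y => z.1.1 *: z.1.2 + z.2) @ (a, u, v) --> a *: u + v.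
  apply: cvgD; last exact: cvg_snd.
  by apply: cvgZ; apply: cvg_comp cvg_fst _; [exact: cvg_fst|exact: cvg_snd].
move=> /cvgL/nbhs_ballP[e /= e0 eU].
have [q /[!in_itv]/= /andP[aq qa]] : exists q : rat, ratr q \in `]a - e, a + e[.
  by apply: rat_in_itvoo; rewrite ltrBlDr -addrA ltrDl addr_gt0.
have [u' [wu' uu']] := wu _ (nbhsx_ballx u e e0).
have [v' [wv' vv']] := wv _ (nbhsx_ballx v e e0).
exists (ratr q *: u' + v'); split; first exact: wD.
apply: (eU (ratr q, u', v')); split => //; split => //=.
by rewrite -ball_normE /= ltr_norml; apply/andP; split; lra.
Qed.

End subspaces.

(** * Candidates *)

Section candidates.
Context {R : realType} {Y : normedModType R}.
Local Notation leb := (@lebesgue_measure R).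

Lemma proper_limit_point (K : set R) (t : R) :
  limit_point K t -> ProperFilter (within K t^').
Proof.
move=> lp; apply: Build_ProperFilter; rewrite /within/= => K0.
have [y [yt Ky]] : exists y, [/\ y != t, K y & y != t -> K y -> False] by exact: lp.
by apply.
Qed.

Lemma frag_derivative_isolated (gamma : fragment Y) t v :
  ~ limit_point (frag_dom gamma) t -> frag_derivative gamma t v.
Proof.
move=> nlp; have [U tU UK] : exists2 U, nbhs t U &
    forall y, U y -> y != t -> ~ frag_dom gamma y.
  apply: contrapT => nU; apply: nlp => U tU; apply: contrapT => ny; apply: nU.
  by exists U => // y Uy yt Ky; apply: ny; exists y.
by move=> A _; apply: (@filterS _ (nbhs t)) tU => s Us st /(UK _ Us st).
Qed.

(** The derivatives provided by the different candidates coincide at an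
accumulation point of the domain. At an isolated point every vector is a
derivative, and [0] belongs to all the subspaces. *)
Lemma candidate_bigcap (mu : {outer_measure set Y -> \bar R})
    (V : nat -> Y -> Gr Y) : (forall k, candidate mu (V k)) ->
  candidate mu (fun x => Gr_bigcap (V ^~ x)).
Proof.
move=> /(_ _)/cid2-/all_sig2[N N0 VN].
exists (\bigcup_k N k); first exact: null_bigcup.
move=> gamma gN.
have /ae_foralln : forall k, {ae leb, forall t, frag_dom gamma t ->
    exists2 v, frag_derivative gamma t v & Gr_set (V k (gamma t)) v}.
  move=> k; apply: VN; apply: negligibleS gN => t [Kt Nt].
  by split => //; exists k.
apply: ae_imply => t tV Kt.
have [lp|nlp] := pselect (limit_point (frag_dom gamma) t); last first.
  exists 0; first exact: frag_derivative_isolated.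
  by move=> k _; exact: Gr0.
have PF := proper_limit_point lp.
have [v gv _] := tV 0%N Kt; exists v => // k _.
have [v' gv' Vv'] := tV k Kt.
by rewrite (cvg_unique (@norm_hausdorff _ _) gv gv').
Qed.

(** Almost every time in the domain is spent in [W], and only countably many of
those times are isolated among them. At the others the derivative is a limit of
difference quotients between points of [W]. *)
Lemma candidate_cst (mu : {outer_measure set Y -> \bar R}) (W : Gr Y) :
  RNP Y -> mu (~` W) = 0%E -> candidate mu (fun=> W).
Proof.
move=> rnp W0; exists (~` W) => // gamma gW.
set K := frag_dom gamma; pose K' := K `&` gamma @^-1` W.
have iso0 : leb.-negligible (isolated K').
  have cK' := @countable_isolated R K'.
  apply/negligibleP; last exact: countable_lebesgue_measure0.
  exact: countable_measurable.
have gd := fragment_differentiable gamma rnp.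
apply: negligibleS (negligibleU gd (negligibleU gW iso0)) => t nP.
apply: contrapT => /not_orP[/contrapT gdt /not_orP[nW niso]]; apply: nP => Kt.
have Wt : Gr_set W (gamma t) by apply: contrapT => nWt; exact: nW.
have lp : limit_point K' t.
  have := @subset_closure _ K' t (conj Kt Wt).
  by rewrite closure_isolated_limit_point => -[/niso|].
have PF := proper_limit_point lp.
have [v gv] := gdt Kt; exists v => //.
have K'K : within K' t^' `=>` within K t^'.
  by apply: within_subset => s -[].
have gv' := cvg_trans (cvg_app _ K'K) gv.
apply: (closed_cvg _ (@Gr_closed _ _ W) _ _ gv').
rewrite near_withinE; near=> s => -[_ Ws].
have /submod_closedP[W0' WD] := Gr_submod W.
rewrite -[_ *: _]addr0; apply: (WD) => //.
by rewrite -[gamma s - _]addrC -scaleN1r; apply: WD.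
Unshelve. all: by end_near. Qed.

Lemma Gr_borel_bigcap (V : nat -> Y -> Gr Y) :
  (forall k, Gr_borel (V k)) -> Gr_borel (fun x => Gr_bigcap (V ^~ x)).
Proof.
move=> bV; rewrite /Gr_borel.
rewrite (_ : mkset _ = \bigcap_k [set xv : Y * Y | Gr_set (V k xv.1) xv.2]).
  exact: borel_bigcap.
by apply/seteqP; split => -[x v] /=.
Qed.

Lemma Gr_borel_cst (W : Gr Y) : Gr_borel (fun=> W : Gr Y).
Proof.
apply: borel_closed; apply: (@preimage_closed _ _ snd W).
  by move=> xv _; exact: cvg_snd.
exact: Gr_closed.
Qed.

End candidates.

(** * The bundle *)

Lemma closure_rational_ball {R : realType} {Y : normedModType R}
    (w : nat -> Y) (y : Y) (U : set Y) :
  closure (range w) y -> nbhs y U -> exists n k : nat,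
    ball (w n) k.+1%:R^-1 y /\ ball (w n) k.+1%:R^-1 `<=` U.
Proof.
move=> wy /nbhs_ballP[e /= e0 eU].
have /ltr_add_invr[k] : 0 < e / 2 by rewrite divr_gt0.
rewrite add0r => ke; have k0 : 0 < k.+1%:R^-1 :> R by rewrite invr_gt0 ltr0n.
have [_ [[n _ <-] yn]] := wy _ (nbhsx_ballx y _ k0).
exists n, k; split; first exact: ball_sym.
move=> z nz; apply: eU; apply: le_ball (ball_triangle yn nz).
by rewrite [e]splitr ltW// ltrD.
Qed.

Lemma locally_finite_cover {R : realType} {Y : normedModType R}
    (mu : {outer_measure set Y -> \bar R}) (w : nat -> Y) :
  locally_finite mu -> exists Q : nat -> set Y,
    [/\ forall j, open (Q j), forall j, (mu (Q j) < +oo)%E &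
        closure (range w) `<=` \bigcup_j Q j].
Proof.
move=> lf; pose B j := let p := odflt (0, 0)%N (unpickle j) in
  ball (w p.1) (p.2.+1%:R^-1 : R).
exists (fun j => if (mu (B j) < +oo)%E then B j else set0); split.
- by move=> j; case: ifP => _; [apply: ball_open; rewrite invr_gt0|exact: open0].
- by move=> j; case: ifP => //; rewrite outer_measure0.
- move=> y wy; have [U yU Uoo] := lf y.
  have [n [k [ny nU]]] := closure_rational_ball wy yU.
  exists (pickle (n, k)) => //; rewrite /B pickleK /= ifT//.
  by rewrite (le_lt_trans _ Uoo)// le_outer_measure.
Qed.

Theorem theorem4p2 (R : realType) (Y : completeNormedModType R)
  (hY : RNP Y) (hYdual : RNP (dual Y))
  (mu : {outer_measure set Y -> \bar R})
  (mu_fin : locally_finite mu) (mu_reg : borel_regular mu)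
  (mu_sep : concentrated_on_separable mu) :
  exists T : Y -> Gr Y, decomposability_bundle mu T.
Proof.
have [E [_ [D [cD _ ED]] E0]] := mu_sep.
have [w [Dw Wsub]] := separable_closed_span cD.
pose W : Gr Y := mkGr (@closed_closure _ (range w)) Wsub.
have W0 : mu (~` W) = 0%E.
  apply: null_sub E0; apply: subsetC; apply: subset_trans ED _.
  exact: closureS.
have [Q [oQ Qoo WQ]] := locally_finite_cover w mu_fin.
pose C : set (Y -> Gr Y) := [set V | Gr_borel V /\ candidate mu V].
have CW : C (fun=> W) by split; [exact: Gr_borel_cst|exact: candidate_cst].
have Cbigcap (V : nat -> Y -> Gr Y) : (forall m, C (V m)) ->
    C (fun x => Gr_bigcap (V ^~ x)).
  move=> CV; split.
    by apply: Gr_borel_bigcap => m; case: (CV m).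
  by apply: candidate_bigcap => m; case: (CV m).
(* An index [(j, n, k)] stands for the set [Q j] and the ball of radius
   [k.+1%:R^-1] around [w n]. *)
pose B (i : nat * nat * nat) := ball (w i.1.2) (i.2.+1%:R^-1 : R).
pose Phi (i : nat * nat * nat) (V : Y -> Gr Y) :=
  [set x | exists2 y, closure (range w) y &
    Q i.1.1 x /\ Gr_set (V x) y /\ B i y].
have PhiQ i V : Phi i V `<=` Q i.1.1 by move=> x [y _ []].
have Phioo i V : (mu (Phi i V) < +oo)%E.
  by rewrite (le_lt_trans _ (Qoo i.1.1))// le_outer_measure.
have Phic i V : Gr_borel V -> mu.-caratheodory (Phi i V).
  move=> bV; pose G := (fst @^-1` Q i.1.1) `&`
    ([set xv : Y * Y | Gr_set (V xv.1) xv.2] `&` (snd @^-1` B i)).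
  apply: (@projection_caratheodory _ _ mu w G) => //; last exact: (Phioo i V).
  apply: borel_setI.
    by apply: borel_open; apply: open_comp => [? _|]; [exact: cvg_fst|exact: oQ].
  apply: borel_setI => //; apply: borel_open; apply: open_comp => [? _|].
    exact: cvg_snd.
  by apply: ball_open; rewrite invr_gt0.
have PhiS i (V V' : Y -> Gr Y) : (forall x, V x `<=` V' x) ->
    Phi i V `<=` Phi i V'.
  move=> VV' x [y wy [Qx [Vy By]]]; exists y => //; split => //; split => //.
  exact: VV'.
(* A minimizing sequence of candidates for each index. *)
have /choice[V VP] : forall i, exists V : nat -> Y -> Gr Y, (forall k, C (V k)) /\
    (fun k => mu (Phi i (V k))) @ \oo --> ereal_inf [set mu (Phi i V') | V' in C].
  move=> i; have [|u uC uinf] := @ereal_inf_seq _ [set mu (Phi i V') | V' in C].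
    by apply/set0P; exists (mu (Phi i (fun=> W))), (fun=> W).
  have /choice[V VP] : forall k, exists V, C V /\ mu (Phi i V) = u k.
    by move=> k; have [V CV <-] := uC k; exists V.
  exists V; split=> [k|]; first by case: (VP k).
  by under eq_fun do rewrite (VP _).2.
(* All the [V i k] in one sequence, with [W] at the code of [None] and at the
   numbers that code nothing. *)
pose Vs m := if unpickle m is Some (Some (i, k)) then V i k else fun=> W.
pose T x := Gr_bigcap (Vs ^~ x).
have CT : C T.
  by apply: Cbigcap => m; rewrite /Vs; case: unpickle => [[[i k]|]|] //; case: (VP i).
have TW x : T x `<=` closure (range w).
  move=> y /(_ (pickle (None : option ((nat * nat * nat) * nat))) I).
  by rewrite /Vs pickleK.
have TV i k x : T x `<=` V i k x.
  by move=> y /(_ (pickle (Some (i, k))) I); rewrite /Vs pickleK.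
have Tmin i V' : C V' -> (mu (Phi i T) <= mu (Phi i V'))%E.
  move=> CV'; apply: (@le_trans _ _ (ereal_inf [set mu (Phi i V') | V' in C])).
    apply: (cvge_to_ge (VP i).2); apply: nearW => k.
    by apply: le_outer_measure; apply: PhiS => x; exact: TV.
  by apply: ereal_inf_lbound; exists V'.
case: (CT) => bT cT; exists T; split => // V' bV' cV'.
pose S x := Gr_bigcap (fun m : nat => if m is 0%N then T x else V' x).
have CS : C S.
  rewrite (_ : S = fun x =>
      Gr_bigcap ((fun m : nat => if m is 0%N then T else V') ^~ x)).
    by apply: Cbigcap => -[].
  by apply/funext => x; rewrite /S; congr Gr_bigcap; apply/funext => -[].
have ST x : S x `<=` T x by move=> y /(_ 0%N I).
have SV' x : S x `<=` V' x by move=> y /(_ 1%N I).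
have null i : mu (Phi i T `\` Phi i S) = 0%E.
  by apply: null_diff; [apply: Phic; case: CS|exact: PhiS|exact: Phioo|exact: Tmin].
apply: (@null_sub _ _ mu _ (~` W `|` \bigcup_i (Phi i T `\` Phi i S))); last first.
  apply/eqP; rewrite eq_le outer_measure_ge0 andbT.
  by rewrite (le_trans (outer_measureU2 _ _ _))// W0 null_bigcup// adde0.
move=> x /= /existsNP[v /not_implyP[Tv nV'v]].
have [Wx|] := pselect (Gr_set W x); last by left.
have [j _ Qx] := WQ x Wx.
have nbV' : nbhs v (~` V' x).
  by apply: open_nbhs_nbhs; split => //; exact/closed_openC/Gr_closed.
have [n [k [nv nV']]] := closure_rational_ball (TW _ _ Tv) nbV'.
right; exists (j, n, k) => //; split; first by exists v => //; exact: TW Tv.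
by move=> [y _ [_ [Sy By]]]; apply: (nV' y By); exact: SV'.
Qed.
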